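(* Let $T\ge 2$ be an integer and let $\mu>0$, $\sigma>0$, $-\frac{1}{T-1}<\rho<1$ satisfy $\mu^2+\rho\sigma^2>0$. Set $\theta=1+(T-1)\rho>0$ and let $\mathcal P$ be the ambiguity set defined in the context. For any $\gamma>0$ we have $$ \sup_{\mathbb P\in\mathcal P}\mathbb P\left(\sum_{t=1}^T\tilde\xi_t\ge\gamma\right)=\begin{cases} \dfrac{T\sigma^2\theta}{T\sigma^2\theta+(\gamma-T\mu)^2} & \text{if } \gamma\ge T\mu+\sigma^2\theta/\mu,\\[1ex] \dfrac{T\mu}{\gamma} & \text{if } T\mu\le\gamma<T\mu+\sigma^2\theta/\mu,\\[1ex] 1 & \text{if } \gamma<T\mu. \end{cases} $$
   Context: Let $\boldsymbol\mu=\mu\boldsymbol 1\in\mathbb R^T$ and $\boldsymbol\Sigma=(1-\rho)\sigma^2\mathbb I+\rho\sigma^2\boldsymbol 1\boldsymbol 1^\intercal$, where $\mathbb I$ is the $T\times T$ identity matrix and $\boldsymbol 1$ the all-ones vector. $\mathcal P$ is the set of all Borel probability distributions $\mathbb P$ of a random vector $\tilde{\boldsymbol\xi}=(\tilde\xi_1,\dots,\tilde\xi_T)^\intercal$ supported on $\mathbb R^T_+$ with $\mathbb E_{\mathbb P}(\tilde{\boldsymbol\xi})=\boldsymbol\mu$ and $\mathbb E_{\mathbb P}(\tilde{\boldsymbol\xi}\tilde{\boldsymbol\xi}^\intercal)=\boldsymbol\Sigma+\boldsymbol\mu\boldsymbol\mu^\intercal$. *)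

(* Defs.v *)
From HB Require Import structures.
From mathcomp Require Import all_boot all_order all_algebra.
From mathcomp Require Import all_classical all_reals all_analysis.

Set Implicit Arguments.
Unset Strict Implicit.
Unset Printing Implicit Defensive.

Import Order.TTheory GRing.Theory Num.Theory.
Import numFieldNormedType.Exports.

Local Open Scope classical_set_scope.
Local Open Scope ring_scope.

(* R^T, carrying the sigma-algebra generated by the coordinate maps into the
   Borel line; since R is second countable, this is the Borel sigma-algebra. *)
Notation euclidean R T := (T.-tuple (measurableTypeR R)).

Definition ones (R : realType) (T : nat) : 'cV[R]_T := const_mx 1.

Definition mean_vec (R : realType) (T : nat) (mu : R) : 'cV[R]_T :=
  mu *: ones R T.

Definition cov_mx (R : realType) (T : nat) (sigma rho : R) : 'M[R]_T :=
  ((1 - rho) * sigma ^+ 2) *: 1%:M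
  + (rho * sigma ^+ 2) *: (ones R T *m (ones R T)^T).

Definition nonneg_orthant (R : realType) (T : nat) : set (euclidean R T) :=
  [set x | forall t : 'I_T, 0 <= tnth x t].

(* Expectations take values in the extended reals, and the integral of a
   function whose positive and negative parts both have infinite integral is
   -oo; equality with a real number therefore includes integrability.
   As the orthant is closed, having support in it means giving it mass 1. *)
Definition ambiguity_set (R : realType) (T : nat) (m : 'cV[R]_T)
    (S : 'M[R]_T) : set (probability (euclidean R T) R) :=
  [set P : probability (euclidean R T) R | [/\ P (@nonneg_orthant R T) = 1%E,
      (forall t : 'I_T,
        expectation P (fun x : euclidean R T => tnth x t) = (m t 0)%:E) &
      (forall s t : 'I_T,
        expectation P (fun x : euclidean R T => tnth x s * tnth x t)
        = ((S + m *m m^T) s t)%:E)]].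

(* Main.v *)
(** The sum [S] of the coordinates is nonnegative with mean [m = T mu] and
    variance [v = T sigma^2 theta], and every finitely supported law on [0, +oo)
    with these two moments is the law of [S] under some element of the ambiguity
    set, so the problem is one-dimensional.  The upper bounds are Cantelli's and
    Markov's, obtained by integrating a quadratic that dominates the indicator
    of [gamma, +oo) on [0, +oo).  The law on [gamma] and [m - v / (gamma - m)]
    attains the bound in the first and third cases; in the middle case it is
    approached by laws on [0], [gamma] and [M] as [M] tends to infinity. *)
Require Import Defs.
From HB Require Import structures.
From mathcomp Require Import all_boot all_order all_algebra.
From mathcomp Require Import all_classical all_reals all_analysis.
From mathcomp Require Import measurable_realfun ring lra.

Set Implicit Arguments.
Unset Strict Implicit.
Unset Printing Implicit Defensive.

Import Order.TTheory GRing.Theory Num.Theory.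
Import numFieldNormedType.Exports.

Local Open Scope classical_set_scope.
Local Open Scope ring_scope.

(** * Finitely supported laws *)

(** The law is a finite sum of weighted Dirac masses. Allowing [f] of any sign serves for moments,
    and indicators give probabilities. *)
Lemma finitely_supported_probability (R : realType) d (X : measurableType d)
    (I : finType) (p : I -> R) (x : I -> X) :
    (forall i, 0 <= p i) -> \sum_i p i = 1 ->
  exists P : probability X R, forall f : X -> R, measurable_fun [set: X] f ->
    expectation P f = (\sum_i p i * f (x i))%:E.
Proof.
move=> p0 p1.
(* [i0] is the default of [nth] when [I] is enumerated; over an empty [I] the weights could not sum
   to 1. *)
have [i0 _|I0] := pickP (@predT I); last first.
  by move: p1; rewrite big_pred0// => /eqP; rewrite eq_sym oner_eq0.
have sumE (F : I -> \bar R) :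
    (\sum_(k < #|I|) F (nth i0 (enum I) k) = \sum_i F i)%E.
  by rewrite -[RHS]big_enum (big_nth i0) big_mkord -cardE.
pose m (k : nat) : {measure set X -> \bar R} :=
  mscale (NngNum (p0 (nth i0 (enum I) k))) (dirac (x (nth i0 (enum I) k))).
pose M : {measure set X -> \bar R} := msum m #|I|.
have ge0E (g : X -> \bar R) : measurable_fun [set: X] g -> (forall y, 0 <= g y)%E ->
    (\int[M]_y g y = \sum_i (p i)%:E * g (x i))%E.
  move=> mg g0; rewrite ge0_integral_measure_sum// -sumE.
  apply: eq_bigr => k _.
  by rewrite ge0_integral_mscale// integral_dirac// diracT mul1e.
have MT : M setT = 1%E.
  rewrite /M/= /msum/= (eq_bigr (fun k : 'I_#|I| => (p (nth i0 (enum I) k))%:E)).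
    by rewrite (sumE (fun i => (p i)%:E)) sumEFin p1.
  by move=> k _; rewrite /m /mscale/= diracT mule1.
pose mM := Measure_isProbability.Build _ _ _ (Measure.sort M) MT.
pose P : probability X R := HB.pack (Measure.sort M) mM.
exists P => f mf.
have mEf : measurable_fun setT (EFin \o f) by exact/measurable_EFinP.
rewrite unlock integralE.
rewrite (ge0E _ (measurable_funepos mEf))// (ge0E _ (measurable_funeneg mEf))//.
under eq_bigr do rewrite funeposE.
under [X in (_ - X)%E]eq_bigr do rewrite funenegE.
under eq_bigr do rewrite -EFin_max -EFinM.
under [X in (_ - X)%E]eq_bigr do rewrite -EFinN -EFin_max -EFinM.
rewrite !sumEFin -EFinB -sumrB; congr EFin; apply: eq_bigr => i _.
rewrite -mulrBr; congr (_ * _).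
have [f0|f0] := leP 0 (f (x i)).
  by rewrite max_r ?subr0// oppr_le0.
by rewrite max_l ?add0r ?opprK// oppr_ge0 ltW.
Qed.

(** * Functions with a real expectation *)

(** For a measurable function a real expectation already forces integrability, so with this pairing
    linearity needs no side condition. *)
Definition has_mean (R : realType) d (X : measurableType d)
    (P : probability X R) (f : X -> R) (r : R) : Prop :=
  measurable_fun [set: X] f /\ expectation P f = r%:E.

Section has_mean.
Context (R : realType) d (X : measurableType d) (P : probability X R).
Implicit Types (f g : X -> R) (r s c : R).

Lemma has_mean_integrable f r :
  has_mean P f r -> P.-integrable [set: X] (EFin \o f).
Proof.
move=> [mf]; rewrite unlock => Ef.
apply/integrableP; split; first exact/measurable_EFinP.
by rewrite integral_fin_num_abs// Ef.
Qed.

Lemma has_mean_cst c : has_mean P (cst c) c.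
Proof. by split; [exact: measurable_cst|exact: expectation_cst]. Qed.

Lemma has_meanD f g r s :
  has_mean P f r -> has_mean P g s -> has_mean P (f \+ g) (r + s).
Proof.
move=> hf hg; have [intf intg] := (has_mean_integrable hf, has_mean_integrable hg).
case: hf hg => mf Ef [mg Eg]; split; first exact: measurable_funD.
by move: Ef Eg; rewrite !unlock => Ef Eg; rewrite integralD_EFin// Ef Eg.
Qed.

Lemma has_meanZ c f r : has_mean P f r -> has_mean P (fun x => c * f x) (c * r).
Proof.
move=> hf; have intf := has_mean_integrable hf.
case: hf => mf Ef; split; first exact: measurable_funM.
move: Ef; rewrite !unlock => Ef.
by under eq_integral do rewrite EFinM; rewrite integralZl// Ef.
Qed.

Lemma has_mean_sum (I : finType) (f : I -> X -> R) (r : I -> R) :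
  (forall i, has_mean P (f i) (r i)) ->
  has_mean P (fun x => \sum_i f i x) (\sum_i r i).
Proof.
move=> hf.
elim: (index_enum I) => [|i s ih].
  by rewrite big_nil; under eq_fun do rewrite big_nil; exact: has_mean_cst.
rewrite big_cons; under eq_fun do rewrite big_cons.
exact: has_meanD.
Qed.

(** The complement of [D] is null, so both integrals restrict to [D]. With the orthant as [D],
    domination is needed only where the sum is nonnegative. *)
Lemma prob_le_mean (A D : set X) f r : measurable A -> measurable D ->
  P D = 1%E -> has_mean P f r ->
  (forall x, D x -> (x \in A)%:R <= f x) -> (P A <= r%:E)%E.
Proof.
move=> mA mD PD hf le_f.
have PDC : P (~` D) = 0%E by rewrite probability_setC// PD subee.
have intA : P.-integrable [set: X] (EFin \o \1_A).
  apply: (@has_mean_integrable _ (fine (P A))); split=> //.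
  by rewrite expectation_indic// fineK// fin_num_measure.
have intf := has_mean_integrable hf.
case: hf => mf; rewrite unlock => <-.
rewrite -[A in leLHS]setIT -integral_indic//.
rewrite (negligible_integral (measurableC mD) measurableT intA PDC).
rewrite (negligible_integral (measurableC mD) measurableT intf PDC).
rewrite setTD setCK; apply: le_integral => //.
- exact: integrableS intA.
- exact: integrableS intf.
- by move=> x /[!inE] Dx; rewrite /= lee_fin indicE; exact: le_f.
Qed.

End has_mean.

(** * Measurability and second moments *)

Lemma measurable_nonneg_orthant (R : realType) (T : nat) :
  measurable (@nonneg_orthant R T).
Proof.
rewrite (_ : @nonneg_orthant R T =
    \bigcap_(t in [set: 'I_T]) ((fun x : euclidean R T => tnth x t : R) @^-1` `[0, +oo[)).
  apply: fin_bigcap_measurable => // t _.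
  by rewrite -[X in measurable X]setTI; exact: measurable_tnth.
apply/seteqP; split=> x /= x0 t; first by rewrite /= in_itv/= andbT x0.
by have := x0 t Logic.I; rewrite /= in_itv/= andbT.
Qed.

Lemma measurable_coord (R : realType) (T : nat) (t : 'I_T) :
  measurable_fun [set: euclidean R T] (fun x => tnth x t : R).
Proof. exact: measurable_tnth. Qed.

Lemma measurable_coord_sum (R : realType) (T : nat) :
  measurable_fun [set: euclidean R T] (fun x : euclidean R T => \sum_(t < T) tnth x t : R).
Proof. by apply: measurable_sum => t; exact: measurable_coord. Qed.

Lemma measurable_upper_half (R : realType) (T : nat) (gamma : R) :
  measurable [set x : euclidean R T | gamma <= \sum_(t < T) tnth x t].
Proof.
rewrite (_ : [set x | _] =
    [set: euclidean R T] `&` (fun x : euclidean R T => \sum_(t < T) tnth x t) @^-1` `[gamma, +oo[).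
  exact: measurable_coord_sum.
by apply/seteqP; split=> x; rewrite /= in_itv/= andbT//; case.
Qed.

Lemma second_momentE (R : realType) (T : nat) (mu sigma rho : R) (s t : 'I_T) :
  (cov_mx T sigma rho + mean_vec T mu *m (mean_vec T mu)^T) s t
  = (1 - rho) * sigma ^+ 2 * (s == t)%:R + (rho * sigma ^+ 2 + mu ^+ 2).
Proof.
by rewrite !mxE !big_ord_recl !big_ord0 !mxE !addr0 !mulr1 addrA -mulr_natr.
Qed.

Lemma sum_second_moment (R : realType) (T : nat) (a b : R) :
  \sum_(s < T) \sum_(t < T) (a * (s == t)%:R + b) = T%:R * a + T%:R ^+ 2 * b.
Proof.
transitivity (\sum_(s < T) (a + T%:R * b)).
  apply: eq_bigr => s _; rewrite big_split/= -mulr_sumr (bigD1 s)//= eqxx.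
  rewrite big1; last by move=> t /negPf; rewrite eq_sym => ->.
  by rewrite addr0 mulr1 sumr_const card_ord mulr_natl.
by rewrite sumr_const card_ord -[LHS]mulr_natl mulrDr mulrA -expr2.
Qed.

(** * Reduction to the law of the sum *)

Section ambiguity.
Context (R : realType) (T : nat) (mu sigma rho : R).
Let theta := 1 + (T%:R - 1) * rho.
Let m := T%:R * mu.
Let v := T%:R * sigma ^+ 2 * theta.

(** Weak duality: the mean of a quadratic in the sum depends only on [m] and [v], so each dominating
    quadratic bounds the whole ambiguity set at once. *)
Lemma ambiguity_tail_le (P : probability (euclidean R T) R)
    (a b c gamma : R) :
    ambiguity_set (mean_vec T mu) (cov_mx T sigma rho) P ->
    (forall s : R, 0 <= s -> (gamma <= s)%R%:R <= a + b * s + c * s ^+ 2) ->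
  (P [set x : euclidean R T | (gamma <= \sum_(t < T) tnth x t)%R]
   <= (a + b * m + c * (v + m ^+ 2))%:E)%E.
Proof.
move=> [P1 mean mom] le_q.
have hS : has_mean P (fun x : euclidean R T => \sum_(t < T) tnth x t) m.
  rewrite (_ : m = \sum_(t < T) mu); last by rewrite sumr_const card_ord -[RHS]mulr_natl.
  apply: has_mean_sum => t; split; first exact: measurable_coord.
  by rewrite mean !mxE mulr1.
have hS2 : has_mean P (fun x : euclidean R T => (\sum_(t < T) tnth x t) ^+ 2) (v + m ^+ 2).
  rewrite (_ : v + m ^+ 2 = \sum_(s < T) \sum_(t < T)
      ((1 - rho) * sigma ^+ 2 * (s == t)%:R + (rho * sigma ^+ 2 + mu ^+ 2))).
    under eq_fun do rewrite expr2 mulr_suml.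
    apply: has_mean_sum => s; under eq_fun do rewrite mulr_sumr.
    apply: has_mean_sum => t; split; last by rewrite mom second_momentE.
    by apply: measurable_funM; exact: measurable_coord.
  by rewrite sum_second_moment /v /m /theta; ring.
apply: (prob_le_mean (D := @nonneg_orthant R T)
  (f := fun x : euclidean R T => a + b * (\sum_(t < T) tnth x t)
                 + c * (\sum_(t < T) tnth x t) ^+ 2)) => //.
- exact: measurable_upper_half.
- exact: measurable_nonneg_orthant.
- apply: has_meanD; last exact: has_meanZ.
  by apply: has_meanD; [exact: has_mean_cst|exact: has_meanZ].
- move=> x x0; rewrite [in leLHS](_ : x \in _ = (gamma <= \sum_(t < T) tnth x t)).
    by apply: le_q; exact: sumr_ge0.
  by apply/idP/idP; rewrite inE.
Qed.


(* The vector is the sum times an independent random point of the simplex: the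
   barycentre with probability [r], each vertex with probability [(1 - r) / T].
   The prescribed cross moment determines [r]. *)
Lemma ambiguity_of_sum_law (J : finType) (p s : J -> R) (gamma : R) :
    (0 < T)%N -> 0 < sigma -> rho < 1 -> 0 < mu ^+ 2 + rho * sigma ^+ 2 ->
    (forall j, 0 <= p j) -> \sum_j p j = 1 -> (forall j, 0 <= s j) ->
    \sum_j p j * s j = m -> \sum_j p j * s j ^+ 2 = v + m ^+ 2 ->
  exists2 P : probability (euclidean R T) R,
    ambiguity_set (mean_vec T mu) (cov_mx T sigma rho) P &
    P [set x | gamma <= \sum_(t < T) tnth x t]
    = (\sum_j p j * (gamma <= s j)%R%:R)%:E.
Proof.
move=> T0 sigma0 rho1 cross p0 p1 s0 ps ps2.
have TR0 : 0 < T%:R :> R by rewrite ltr0n.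
have vmE : v + m ^+ 2 = T%:R ^+ 2 * (mu ^+ 2 + rho * sigma ^+ 2)
                        + T%:R * sigma ^+ 2 * (1 - rho).
  by rewrite /v /m /theta; ring.
have diag0 : 0 < T%:R * sigma ^+ 2 * (1 - rho).
  by rewrite !mulr_gt0 ?exprn_gt0// subr_gt0.
have cross0 : 0 < T%:R ^+ 2 * (mu ^+ 2 + rho * sigma ^+ 2).
  by rewrite mulr_gt0 ?exprn_gt0.
have vm0 : 0 < v + m ^+ 2 by rewrite vmE addr_gt0.
(* Vertices contribute nothing to a cross moment, which is therefore [r * (v + m ^+ 2) / T%:R ^+ 2];
   equating it to [mu ^+ 2 + rho * sigma ^+ 2] gives [r]. *)
pose r := T%:R ^+ 2 * (mu ^+ 2 + rho * sigma ^+ 2) / (v + m ^+ 2).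
have r0 : 0 <= r by rewrite divr_ge0// ltW.
have r1 : r <= 1 by rewrite ler_pdivrMr// mul1r vmE lerDl ltW.
(* [None] encodes the barycentre and [Some k] the vertex [k]. *)
pose w (k : option 'I_T) : R := if k is Some _ then (1 - r) / T%:R else r.
pose u (k : option 'I_T) (t : 'I_T) : R :=
  if k is Some k' then (k' == t)%:R else T%:R^-1.
have sum_option (F : option 'I_T -> R) :
    \sum_k F k = F None + \sum_t F (Some t).
  rewrite (bigD1 None)//=; congr (_ + _).
  rewrite (reindex_omap Some id) //=; first by apply: eq_bigl => t; rewrite eqxx.
  by case.
have sum_delta (F : 'I_T -> R) t : \sum_k F k * (k == t)%:R = F t.
  rewrite (bigD1 t)//= eqxx mulr1 big1 ?addr0// => k /negPf ->.
  by rewrite mulr0.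
have w0 k : 0 <= w k.
  by case: k => [k|]//=; rewrite divr_ge0 ?subr_ge0// ltW.
have u0 k t : 0 <= u k t by case: k => [k|]//=; rewrite invr_ge0 ltW.
have w1 : \sum_k w k = 1.
  rewrite sum_option /= sumr_const card_ord -[X in _ + X]mulr_natl.
  by field; rewrite gt_eqF.
have u1 k : \sum_t u k t = 1.
  case: k => [k|]/=.
    by under eq_bigr do rewrite eq_sym -[_%:R]mul1r; exact: sum_delta.
  by rewrite sumr_const card_ord -[LHS]mulr_natl divff// gt_eqF.
have wu t : \sum_k w k * u k t = T%:R^-1.
  by rewrite sum_option /= sum_delta; field; rewrite gt_eqF.
have wuu a b : \sum_k w k * (u k a * u k b)
    = r / T%:R ^+ 2 + (1 - r) / T%:R * (a == b)%:R.
  rewrite sum_option /=; congr (_ + _); first by field; rewrite gt_eqF.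
  under eq_bigr do rewrite mulrCA mulrC -mulrA [_%:R * _]mulrC mulrA.
  by rewrite sum_delta mulrC eq_sym mulrC.
(* Independence of the sum and the simplex point: every moment below factors. *)
have split_sum (F : J -> R) (G : option 'I_T -> R) :
    \sum_i (F i.1 * G i.2) = (\sum_j F j) * (\sum_k G k).
  by rewrite big_distrlr/= pair_big.
pose x (i : J * option 'I_T) : euclidean R T := [tuple s i.1 * u i.2 t | t < T].
have xE i t : tnth (x i) t = s i.1 * u i.2 t by rewrite tnth_mktuple.
have [||P EP] := @finitely_supported_probability R _ (euclidean R T) _
  (fun i : J * option 'I_T => p i.1 * w i.2) x.
- by move=> i; exact: mulr_ge0.
- by rewrite split_sum p1 w1 mulr1.
have probE A : measurable A ->
    P A = (\sum_i p i.1 * w i.2 * (x i \in A)%:R)%:E.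
  by move=> mA; rewrite -expectation_indic// EP.
exists P.
  split.
  - rewrite probE; last exact: measurable_nonneg_orthant.
    under eq_bigr => i _.
      rewrite mem_set ?mulr1; last by move=> t; rewrite xE mulr_ge0.
      over.
    by rewrite split_sum p1 w1 mulr1.
  - move=> t; rewrite EP; last exact: measurable_coord.
    under eq_bigr do rewrite xE mulrACA.
    rewrite (split_sum (fun j => p j * s j) (fun k => w k * u k t)) ps wu.
    by rewrite !mxE mulr1 /m mulrAC divff ?mul1r// gt_eqF.
  - move=> a b; rewrite EP; last by apply: measurable_funM; exact: measurable_coord.
    transitivity ((\sum_i p i.1 * s i.1 ^+ 2 * (w i.2 * (u i.2 a * u i.2 b)))%:E).
      by congr EFin; apply: eq_bigr => i _; rewrite !xE; ring.
    rewrite (split_sum (fun j => p j * s j ^+ 2) (fun k => w k * (u k a * u k b))).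
    rewrite ps2 wuu second_momentE; congr EFin.
    transitivity (r * (v + m ^+ 2) / T%:R ^+ 2
        + (v + m ^+ 2 - r * (v + m ^+ 2)) / T%:R * (a == b)%:R); first by ring.
    rewrite /r divfK ?lt0r_neq0// vmE.
    by field; rewrite lt0r_neq0.
rewrite probE; last exact: measurable_upper_half.
congr EFin.
transitivity (\sum_(i : J * option 'I_T) p i.1 * (gamma <= s i.1)%R%:R * w i.2).
  apply: eq_bigr => i _; rewrite mulrAC; congr (_ * (nat_of_bool _)%:R * _).
  (* Points of the simplex have coordinate sum 1, so the tail event sees only [s]. *)
  have sumx : \sum_(t < T) tnth (x i) t = s i.1.
    by under eq_bigr do rewrite xE; rewrite -mulr_sumr u1 mulr1.
  by apply/idP/idP; rewrite inE /= sumx.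
by rewrite (split_sum (fun j => p j * (gamma <= s j)%R%:R)) w1 mulr1.
Qed.

End ambiguity.

(** * Extremal laws on the half-line *)

(** The variance forces [(gamma - m) * (m - b) = v], and the mean then gives [p]. Either sign of
    [gamma - m] is allowed; [b] lies across [m] from [gamma]. *)
Lemma two_point_law (R : realType) (m v gamma : R) :
    0 < v -> gamma != m ->
  let b := m - v / (gamma - m) in
  let p := v / (v + (gamma - m) ^+ 2) in
  [/\ 0 <= p <= 1, p * gamma + (1 - p) * b = m &
      p * gamma ^+ 2 + (1 - p) * b ^+ 2 = v + m ^+ 2].
Proof.
move=> v0 gm b p.
have dm0 : gamma - m != 0 by rewrite subr_eq0.
have d0 : 0 < v + (gamma - m) ^+ 2 by rewrite ltr_wpDr// sqr_ge0.
have dn0 : v + (gamma - m) ^+ 2 != 0 by rewrite lt0r_neq0.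
split; last 2 first.
- by rewrite /p /b; field; rewrite dm0 dn0.
- by rewrite /p /b; field; rewrite dm0 dn0.
apply/andP; split; first by rewrite divr_ge0 ?ltW.
by rewrite ler_pdivrMr// mul1r lerDl sqr_ge0.
Qed.

(* The weights [p] at [gamma] and [r] at [M] leave the mass [1 - (p + r)] at [0]. *)
Lemma three_point_law (R : realType) (m k gamma M : R) :
    0 < m <= gamma -> 0 <= k -> gamma < M -> k / m + gamma <= M ->
  let r := k / (M * (M - gamma)) in
  let p := (m - r * M) / gamma in
  [/\ 0 <= r /\ 0 <= p, p + r = m / gamma - k / (gamma * M),
      p + r <= 1, p * gamma + r * M = m &
      p * gamma ^+ 2 + r * M ^+ 2 = k + m * gamma].
Proof.
move=> /andP[m0 mg] k0 gM kM r p.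
have g0 : 0 < gamma by exact: lt_le_trans mg.
have M0 : 0 < M by exact: lt_trans gM.
have Mg0 : 0 < M - gamma by rewrite subr_gt0.
have [gn Mn Mgn] : [/\ gamma != 0, M != 0 & M - gamma != 0].
  by rewrite !lt0r_neq0.
have prE : p + r = m / gamma - k / (gamma * M).
  by rewrite /p /r; field; rewrite Mgn Mn gn.
split=> //.
- split; first by rewrite divr_ge0// mulr_ge0 ?ltW.
  apply: divr_ge0 (ltW g0); rewrite subr_ge0.
  (* The share of the mean carried by [M] is [k / (M - gamma)], at most [m] by [kM]. *)
  rewrite (_ : r * M = k / (M - gamma)); last by rewrite /r; field; rewrite Mgn Mn.
  by rewrite ler_pdivrMr// mulrC -ler_pdivrMr// lerBrDr.
- rewrite prE lerBlDr (le_trans (y := 1))//; first by rewrite ler_pdivrMr// mul1r.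
  by rewrite lerDl divr_ge0// mulr_ge0 ?ltW.
- by rewrite /p /r; field; rewrite Mgn Mn gn.
- by rewrite /p /r; field; rewrite Mgn Mn gn.
Qed.

(** * Matching bounds in the three ranges of [gamma] *)

Theorem theorem6p2 (R : realType) (T : nat) (mu sigma rho gamma : R)
    (hT : (2 <= T)%N) (hmu : 0 < mu) (hsigma : 0 < sigma)
    (hrho_gt : - (1 / (T%:R - 1)) < rho) (hrho_lt : rho < 1)
    (hcross : 0 < mu ^+ 2 + rho * sigma ^+ 2)
    (hgamma : 0 < gamma) :
  let theta := 1 + (T%:R - 1) * rho in
  ereal_sup [set P [set x : euclidean R T | gamma <= \sum_(t < T) tnth x t]
            | P in ambiguity_set (mean_vec T mu) (cov_mx T sigma rho)]
  = (if T%:R * mu + sigma ^+ 2 * theta / mu <= gamma then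
       T%:R * sigma ^+ 2 * theta
       / (T%:R * sigma ^+ 2 * theta + (gamma - T%:R * mu) ^+ 2)
     else if T%:R * mu <= gamma then T%:R * mu / gamma
     else 1)%:E.
Proof.
move=> theta.
have T0 : (0 < T)%N by exact: ltnW.
have TR0 : 0 < T%:R :> R by rewrite ltr0n.
have T1 : 0 < T%:R - 1 :> R by rewrite subr_gt0 ltr1n.
have theta0 : 0 < theta.
  by move: hrho_gt; rewrite ltrNl ltr_pdivlMr// /theta; lra.
set m := T%:R * mu; set v := T%:R * sigma ^+ 2 * theta.
have m0 : 0 < m by rewrite mulr_gt0.
have v0 : 0 < v by rewrite !mulr_gt0// exprn_gt0.
(* In terms of the sum, the threshold is [m + v / m]. *)
have -> : sigma ^+ 2 * theta / mu = v / m.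
  by rewrite /v /m; field; rewrite !lt0r_neq0.
set tail := [set x : euclidean R T | _].
set amb := ambiguity_set _ _.
have law (J : finType) (p s : J -> R) := @ambiguity_of_sum_law R T mu sigma rho
  J p s gamma T0 hsigma hrho_lt hcross.
have upper P a b c := @ambiguity_tail_le R T mu sigma rho P a b c gamma.
have lower P : amb P -> (P tail <= ereal_sup [set P tail | P in amb])%E.
  by move=> ambP; apply: ereal_sup_ubound; exists P.
(* The last term records whether the second atom [b] also falls in the tail: it does not in the
   first case and does in the third. *)
have two_point (b := m - v / (gamma - m)) (p := v / (v + (gamma - m) ^+ 2)) :
    gamma != m -> 0 <= b ->
    exists2 P, amb P & P tail = (p + (1 - p) * (gamma <= b)%R%:R)%:E.
  move=> gm b0; have [/andP[p0 p1] Em Ev] := two_point_law v0 gm.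
  have [| | | | |P ambP PE] := law bool (fun i => if i then p else 1 - p)
    (fun i => if i then gamma else b).
  - by case=> //; rewrite subr_ge0.
  - by rewrite big_bool /= addrC subrK.
  - by case=> //; exact: ltW.
  - by rewrite big_bool.
  - by rewrite big_bool.
  by exists P; rewrite // PE big_bool /= lexx mulr1.
apply/eqP; rewrite eq_le; apply/andP; split.
  apply: ge_ereal_sup => _ [P ambP <-].
  case: ifPn => [g_ge|_].
    have d0 : 0 < gamma - m.
      by rewrite subr_gt0 (lt_le_trans _ g_ge)// ltrDl divr_gt0.
    pose b := m - v / (gamma - m).
    have gb0 : 0 < gamma - b.
      by rewrite /b opprB addrCA addrC addr_gt0// divr_gt0.
    have d2 : v + (gamma - m) ^+ 2 != 0 by rewrite lt0r_neq0// addr_gt0// exprn_gt0.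
    (* [1 <= ((s - b) / (gamma - b)) ^+ 2] for [gamma <= s] *)
    have := upper P (b ^+ 2 / (gamma - b) ^+ 2) (- 2 * b / (gamma - b) ^+ 2)
      ((gamma - b) ^+ 2)^-1 ambP.
    rewrite (_ : _ + _ * (v + _) = v / (v + (gamma - m) ^+ 2)); last first.
      by rewrite /b -/m -/v; field; rewrite d2 lt0r_neq0.
    apply=> s s0.
    rewrite [leRHS](_ : _ = ((s - b) / (gamma - b)) ^+ 2); last first.
      by field; rewrite lt0r_neq0.
    case: (leP gamma s) => [gs|_]; last exact: sqr_ge0.
    by rewrite exprn_ege1// ler_pdivlMr// mul1r lerD2r.
  case: ifPn => [_|_]; last first.
    by apply: probability_le1; exact: measurable_upper_half.
  (* Markov's bound: the dominating function is [s / gamma]. *)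
  have := upper P 0 gamma^-1 0 ambP.
  rewrite add0r mul0r addr0 mulrC; apply=> s s0.
  rewrite add0r mul0r addr0 mulrC.
  case: (leP gamma s) => [gs|_]; last by rewrite divr_ge0// ltW.
  by rewrite ler_pdivlMr// mul1r.
case: ifPn => [g_ge|].
  have d0 : 0 < gamma - m.
    by rewrite subr_gt0 (lt_le_trans _ g_ge)// ltrDl divr_gt0.
  have [||P ambP PE] := two_point; first by rewrite -subr_eq0 lt0r_neq0.
    (* [0 <= b] amounts to [v / m <= gamma - m], which is the case condition. *)
    by rewrite subr_ge0 ler_pdivrMr// mulrC -ler_pdivrMr// lerBrDl.
  rewrite (le_trans _ (lower _ ambP))// PE (leNgt gamma) (_ : _ < gamma) ?mulr0 ?addr0//.
  by rewrite (lt_trans _ (_ : m < _))// ?gtrBl ?divr_gt0// -subr_gt0.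
rewrite -ltNge => g_lt; case: ifPn => [m_le|]; last first.
  rewrite -ltNge => gm.
  have d0 : 0 < m - gamma by rewrite subr_gt0.
  (* Here [gamma < m < b], so both atoms lie in the tail and the probability is 1. *)
  have bE : m - v / (gamma - m) = m + v / (m - gamma).
    by rewrite -[gamma - m]opprB invrN mulrN opprK.
  have [||P ambP PE] := two_point; first by rewrite lt_eqF.
    by rewrite bE addr_ge0 ?divr_ge0// ltW.
  rewrite (le_trans _ (lower _ ambP))// PE bE.
  rewrite (_ : gamma <= _); first by rewrite mulr1 addrC subrK.
  by rewrite (le_trans (ltW gm))// lerDl divr_ge0 ?ltW.
apply/lee_addgt0Pr => e e0.
(* [k] is the mean of [S * (S - gamma)] for the sum [S]. The atoms 0 and [gamma] add nothing to it,
   so [M] carries it all; [k0] is the case condition times [m]. *)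
pose k := v + m ^+ 2 - m * gamma.
have k0 : 0 < k.
  have : m * gamma < m * (m + v / m) by rewrite ltr_pM2l.
  by rewrite mulrDr [m * (v / m)]mulrC divfK ?lt0r_neq0// /k; lra.
(* [gamma + 1] puts [M] beyond [gamma], [k / m] keeps the weight at [gamma] nonnegative, and
   [k / (gamma * e)] makes the loss at most [e]. *)
pose M := gamma + 1 + k / m + k / (gamma * e).
have [km0 kge0] : 0 < k / m /\ 0 < k / (gamma * e) by rewrite !divr_gt0// mulr_gt0.
have M0 : 0 < M by rewrite !addr_gt0.
have [||||[r0 p0] prE pr1 Em Ev] := @three_point_law R m k gamma M.
- by rewrite m0.
- exact: ltW.
- by rewrite /M; lra.
- by rewrite /M; lra.
set r := k / (M * _) in r0 p0 prE pr1 Em Ev.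
set p := _ / gamma in p0 prE pr1 Em Ev.
have [| | | | |P ambP PE] := law 'I_3 (fun i => [:: 1 - (p + r); p; r]`_i)
    (fun i => [:: 0; gamma; M]`_i).
- by case=> [[|[|[|]]]]//= _; rewrite subr_ge0.
- by rewrite !big_ord_recl big_ord0 /=; ring.
- by case=> [[|[|[|]]]]//= _; exact: ltW.
- by rewrite !big_ord_recl big_ord0 /= -/m -Em; ring.
- rewrite !big_ord_recl big_ord0 /= -/m -/v (_ : v + _ = k + m * gamma).
    by rewrite -Ev; ring.
  by rewrite /k; ring.
have PtailE : P tail = (p + r)%:E.
  rewrite PE !big_ord_recl big_ord0 /= leNgt hgamma lexx.
  rewrite (_ : gamma <= M); last by rewrite /M; lra.
  by congr EFin; rewrite /=; ring.
rewrite (le_trans _ (leeD2r _ (lower _ ambP)))// PtailE -EFinD lee_fin prE.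
(* The tail probability falls short of [m / gamma] by exactly [k / (gamma * M)]. *)
suff : k / (gamma * M) <= e by lra.
rewrite ler_pdivrMr ?mulr_gt0// mulrCA mulrA mulrC -ler_pdivrMr ?mulr_gt0// /M.
by move: km0 kge0; lra.
Qed.
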